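(* Let $n\in\mathbb N$ and $P=[-\tfrac12,\tfrac32+2n]^n\subseteq\mathbb R^n$. Consider branch-and-cut trees based on any subfamily $\mathcal D$ of the split disjunctions in $\mathbb R^n$ that includes all variable disjunctions. Then the facet complexity of $P\cap\mathbb Z^n$ with respect to $P$ is $3$, and the hull complexity of $P\cap\mathbb Z^n$ with respect to $P$ is $4n+1$.
   Context: A split disjunction is the pair $\{x\in\mathbb R^n:\langle\alpha,x\rangle\le\beta\}$, $\{x\in\mathbb R^n:\langle\alpha,x\rangle\ge\beta+1\}$ with $\alpha\in\mathbb Z^n\setminus\{0\}$, $\beta\in\mathbb Z$; its split set is $\{x:\beta<\langle\alpha,x\rangle<\beta+1\}$. A variable disjunction is a split disjunction with $\alpha$ a standard unit vector, i.e. $\{x_i\le\beta\}$, $\{x_i\ge\beta+1\}$. A branch-and-cut tree based on a family $\mathcal D$ of split disjunctions is a finite rooted tree in which every node has a corresponding convex set in $\mathbb R^n$, the root having the set $P$. An internal node with set $K$ is of one of two types: (a) branching: it is labelled by a split disjunction $D_1,D_2$ in $\mathcal D$ and has two children, with sets $K\cap D_1$ and $K\cap D_2$; (b) cutting: it is labelled by a halfspace $H$ (a convex set $H\subseteq\mathbb R^n$ with convex complement $H^c$) derived from a split disjunction $D_1,D_2$ in $\mathcal D$, meaning $K\cap D_1\subseteq H$ and $K\cap D_2\subseteq H$ (equivalently, $K\cap H^c$ is contained in the split set); it has two children: the right child has set $K\cap H$, and the left child is a leaf with set $K\cap H^c$, called a cutting plane certifier, which carries a certificate that $K\cap H^c\cap\mathbb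 Z^n=\emptyset$, of positive integer size. The size of the tree is its number of nodes plus the sum of the sizes of the certificates at the cutting plane certifiers. For a set $Q$ with $\operatorname{conv}(P\cap\mathbb Z^n)\subseteq Q$, a tree proves $Q$ if, for every leaf that is not a cutting plane certifier, the corresponding set is contained in $Q$. The hull complexity is the smallest size of a tree that proves $\operatorname{conv}(P\cap\mathbb Z^n)$. The validity complexity of a halfspace $H\supseteq P\cap\mathbb Z^n$ is the smallest size of a tree that proves $H$. The validity complexity of a facet of $\operatorname{conv}(P\cap\mathbb Z^n)$ is the minimum validity complexity of the halfspaces defining it, and the facet complexity is the maximum validity complexity over all facets of $\operatorname{conv}(P\cap\mathbb Z^n)$. *)

(* Defs.v *)
From mathcomp Require Import all_boot all_order all_algebra.
From mathcomp Require Import all_classical all_reals convex.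

Set Implicit Arguments.
Unset Strict Implicit.
Unset Printing Implicit Defensive.

Import Order.TTheory GRing.Theory Num.Theory.
Local Open Scope classical_set_scope.
Local Open Scope ring_scope.

Definition dotp (R : realType) (n : nat) (a x : 'rV[R]_n) : R :=
  \sum_(i < n) a ord0 i * x ord0 i.

Definition int_lattice (R : realType) (n : nat) : set 'rV[R]_n :=
  [set x | forall i, x ord0 i \is a Num.int].
Arguments int_lattice : clear implicits.

Definition conv_hull (R : realType) (n : nat) (A : set 'rV[R]_n) :
    set 'rV[R]_n :=
  smallest (@convex_set R 'rV[R]_n) A.

Definition integer_hull (R : realType) (n : nat) (P : set 'rV[R]_n) :=
  conv_hull (P `&` int_lattice R n).

(* In contrast with closed_halfspace below, a halfspace may contain only part
   of its bounding hyperplane, and set0 and setT are allowed. *)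
Definition halfspace (R : realType) (n : nat) (H : set 'rV[R]_n) : Prop :=
  convex_set H /\ convex_set (~` H).

Record split_disj (n : nat) := SplitDisj {
  split_normal : 'rV[int]_n ;
  split_bound : int ;
  split_normal_neq0 : split_normal != 0
}.

Definition split_lo (R : realType) (n : nat) (d : split_disj n) :
    set 'rV[R]_n :=
  [set x | dotp (map_mx intr (split_normal d)) x <= (split_bound d)%:~R].

Definition split_hi (R : realType) (n : nat) (d : split_disj n) :
    set 'rV[R]_n :=
  [set x | (split_bound d + 1)%:~R <= dotp (map_mx intr (split_normal d)) x].

Definition variable_disj (n : nat) : set (split_disj n) :=
  [set d | exists i : 'I_n, split_normal d = delta_mx ord0 i].
Arguments variable_disj : clear implicits.

(* The nature of the certificates of integer-freeness is left open: an
   abstract certificate language is only required to be sound and to assign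
   positive sizes. *)
Record cert_system (R : realType) (n : nat) := CertSystem {
  cert : Type ;
  certifies : cert -> set 'rV[R]_n -> Prop ;
  cert_size : cert -> nat ;
  certifies_sound : forall c A, certifies c A -> A `&` int_lattice R n = set0 ;
  cert_size_gt0 : forall c, (0 < cert_size c)%N
}.

(* The sets attached to the nodes are determined by the set at the root and by
   the labels, so that a tree only records the labels. In [Cut d H c t], the
   left child is the cutting plane certifier, with certificate c, and t is the
   subtree rooted at the right child. *)
Inductive bct (R : realType) (n : nat) (C : cert_system R n) :=
| Leaf
| Branch of split_disj n & bct C & bct C
| Cut of split_disj n & set 'rV[R]_n & cert C & bct C.

Fixpoint bct_wf (R : realType) (n : nat) (C : cert_system R n)
    (D : set (split_disj n)) (K : set 'rV[R]_n) (t : bct C) : Prop :=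
  match t with
  | Leaf => True
  | Branch d t1 t2 =>
      [/\ D d, bct_wf D (K `&` split_lo d) t1 & bct_wf D (K `&` split_hi d) t2]
  | Cut d H c t' =>
      [/\ D d /\ halfspace H,
          K `&` split_lo d `<=` H /\ K `&` split_hi d `<=` H,
          certifies c (K `&` ~` H) &
          bct_wf D (K `&` H) t']
  end.

(* The cutting plane certifiers are exempted. *)
Fixpoint bct_leaves_in (R : realType) (n : nat) (C : cert_system R n)
    (Q K : set 'rV[R]_n) (t : bct C) : Prop :=
  match t with
  | Leaf => K `<=` Q
  | Branch d t1 t2 =>
      bct_leaves_in Q (K `&` split_lo d) t1 /\
      bct_leaves_in Q (K `&` split_hi d) t2
  | Cut _ H _ t' => bct_leaves_in Q (K `&` H) t'
  end.

Fixpoint bct_size (R : realType) (n : nat) (C : cert_system R n)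
    (t : bct C) : nat :=
  match t with
  | Leaf => 1
  | Branch _ t1 t2 => (1 + bct_size t1 + bct_size t2)%N
  | Cut _ _ c t' => (1 + (1 + cert_size c) + bct_size t')%N
  end.

Definition bct_proves (R : realType) (n : nat) (C : cert_system R n)
    (D : set (split_disj n)) (P Q : set 'rV[R]_n) (t : bct C) : Prop :=
  [/\ integer_hull P `<=` Q, bct_wf D P t & bct_leaves_in Q P t].

(* A complexity is a relation to its value k, as it is undefined (infinite)
   when no tree proves the set at hand. *)
Definition is_minimum (A : set nat) (k : nat) : Prop := A k /\ lbound A k.

Definition proof_complexity (R : realType) (n : nat) (C : cert_system R n)
    (D : set (split_disj n)) (P Q : set 'rV[R]_n) (k : nat) : Prop :=
  is_minimum [set bct_size t | t in [set t : bct C | bct_proves D P Q t]] k.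

Definition hull_complexity (R : realType) (n : nat) (C : cert_system R n)
    (D : set (split_disj n)) (P : set 'rV[R]_n) (k : nat) : Prop :=
  proof_complexity C D P (integer_hull P) k.

Definition validity_complexity (R : realType) (n : nat) (C : cert_system R n)
    (D : set (split_disj n)) (P H : set 'rV[R]_n) (k : nat) : Prop :=
  proof_complexity C D P H k.

Definition closed_halfspace (R : realType) (n : nat) (a : 'rV[R]_n) (b : R) :
    set 'rV[R]_n :=
  [set x | dotp a x <= b].

Definition hyperplane (R : realType) (n : nat) (a : 'rV[R]_n) (b : R) :
    set 'rV[R]_n :=
  [set x | dotp a x = b].

Definition face (R : realType) (n : nat) (Q F : set 'rV[R]_n) : Prop :=
  exists a b, Q `<=` closed_halfspace a b /\ F = Q `&` hyperplane a b.

Definition proper_face (R : realType) (n : nat) (Q F : set 'rV[R]_n) : Prop :=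
  [/\ face Q F, F !=set0 & F <> Q].

Definition facet (R : realType) (n : nat) (Q F : set 'rV[R]_n) : Prop :=
  proper_face Q F /\ forall G, proper_face Q G -> F `<=` G -> G = F.

Definition defines_facet (R : realType) (n : nat) (Q F H : set 'rV[R]_n) :
    Prop :=
  exists a b, [/\ a != 0, H = closed_halfspace a b, Q `<=` H &
                  F = Q `&` hyperplane a b].

Definition facet_validity_complexity (R : realType) (n : nat)
    (C : cert_system R n) (D : set (split_disj n)) (P F : set 'rV[R]_n)
    (k : nat) : Prop :=
  is_minimum [set m | exists2 H, defines_facet (integer_hull P) F H &
                                 validity_complexity C D P H m] k.

(* Every facet must have a (finite) validity complexity. *)
Definition facet_complexity (R : realType) (n : nat) (C : cert_system R n)
    (D : set (split_disj n)) (P : set 'rV[R]_n) (k : nat) : Prop :=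
  (exists2 F, facet (integer_hull P) F & facet_validity_complexity C D P F k) /\
  (forall F, facet (integer_hull P) F ->
     exists2 m, facet_validity_complexity C D P F m & (m <= k)%N).

Definition half_cube (R : realType) (n : nat) : set 'rV[R]_n :=
  [set x | forall i, - (1 / 2) <= x ord0 i <= 3 / 2 + 2 * n%:R].
Arguments half_cube : clear implicits.

(* Main.v *)
Require Import Defs.
From mathcomp Require Import all_boot all_order all_algebra.
From mathcomp Require Import all_classical all_reals convex.
From mathcomp Require Import interval_inference zify ring lra.

(** For the lower bound on the hull complexity, a point of [P] which lies in
    none of the split sets of a tree reaches a leaf that is not a certifier, so
    the split sets of a tree proving the hull cover [P] minus the hull. Suppose
    that there are fewer than [2n] of them. On a facet of [P], a split set whose
    normal is not parallel to that of the facet contains points with integral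
    free coordinates on one hyperplane only, and fewer than [2n] hyperplanes
    cannot cover the grid of side [2n + 2]. Hence each of the [2n] facets of [P]
    meets a split set parallel to it; these are pairwise distinct, which is a
    contradiction. Finally every internal node contributes at least 2 to the
    size. *)

Set Implicit Arguments.
Unset Strict Implicit.
Unset Printing Implicit Defensive.

Import Order.TTheory GRing.Theory Num.Theory.
Local Open Scope classical_set_scope.
Local Open Scope ring_scope.

(** * Changing one coordinate, and dot products *)

Definition row_set (R : realType) (n : nat) (x : 'rV[R]_n) (k : 'I_n) (t : R) :
    'rV[R]_n :=
  \row_j (if j == k then t else x ord0 j).

Lemma row_setE (R : realType) (n : nat) (x : 'rV[R]_n) (k j : 'I_n) (t : R) :
  row_set x k t ord0 j = if j == k then t else x ord0 j.
Proof. by rewrite mxE. Qed.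

Lemma dotp_row_set (R : realType) (n : nat) (a x : 'rV[R]_n) (k : 'I_n) (t : R) :
  dotp a (row_set x k t) = dotp a x + a ord0 k * (t - x ord0 k).
Proof.
rewrite /dotp (bigD1 k)//= [in RHS](bigD1 k)//= row_setE eqxx.
rewrite (eq_bigr (fun i => a ord0 i * x ord0 i)); last first.
  by move=> j /negPf jk; rewrite row_setE jk.
ring.
Qed.

Lemma dotp_single (R : realType) (n : nat) (a x : 'rV[R]_n) (i : 'I_n) :
  (forall j, j != i -> a ord0 j = 0) -> dotp a x = a ord0 i * x ord0 i.
Proof.
move=> a0; rewrite /dotp (bigD1 i)//= big1 ?addr0// => j ji.
by rewrite a0// mul0r.
Qed.

Lemma dotp_delta (R : realType) (n : nat) (x : 'rV[R]_n) (i : 'I_n) :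
  dotp (map_mx intr (delta_mx ord0 i : 'rV[int]_n)) x = x ord0 i.
Proof.
rewrite (@dotp_single _ _ _ _ i) => [|j /negPf ji]; rewrite !mxE ?ji//=.
by rewrite !eqxx mul1r.
Qed.

Lemma convE (R : realType) (n : nat) (x y : 'rV[R]_n) (t : {i01 R}) (i : 'I_n) :
  (conv t (x : convex_lmodType 'rV[R]_n) y : 'rV[R]_n) ord0 i =
  t%:num * x ord0 i + (1 - t%:num) * y ord0 i.
Proof. by rewrite /conv/= !mxE. Qed.

(** * The integer hull of the cube is a box *)

Definition box (R : realType) (n : nat) (a b : R) : set 'rV[R]_n :=
  [set x | forall i, a <= x ord0 i <= b].
Arguments box {R} n a b.

Lemma convex_box (R : realType) (n : nat) (a b : R) :
  convex_set (box n a b : set (convex_lmodType 'rV[R]_n)).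
Proof.
move=> x y t /set_mem xab /set_mem yab; apply/mem_set => i.
rewrite convE; have /andP[ax xb] := xab i; have /andP[ay yb] := yab i.
have t0 : 0 <= t%:num by []; have t1 : t%:num <= 1 by [].
move: t%:num (x ord0 i) (y ord0 i) t0 t1 ax xb ay yb => s u v *.
by apply/andP; split; nra.
Qed.

(** Induction on the number [k] of leading coordinates that may take non-extreme values: a point is
    the convex combination, with weight [x_k / m], of the points obtained by moving its coordinate
    [x_k] to [m] and to 0. *)
Lemma box_sub_convex (R : realType) (n : nat) (m : R) (A : set 'rV[R]_n) :
  0 < m -> convex_set (A : set (convex_lmodType 'rV[R]_n)) ->
  (forall x : 'rV[R]_n, (forall i, x ord0 i = 0 \/ x ord0 i = m) -> A x) ->
  box n 0 m `<=` A.
Proof.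
move=> m0 cA vA x xbox.
have H k : (k <= n)%N -> forall x : 'rV[R]_n, box n 0 m x ->
    (forall i : 'I_n, (k <= i)%N -> x ord0 i = 0 \/ x ord0 i = m) -> A x.
  elim: k => [_ {xbox}x xbox xv|k IH kn {xbox}x xbox xv].
    by apply: vA => i; exact: xv.
  pose k' := Ordinal kn.
  have side v : v = 0 \/ v = m -> A (row_set x k' v).
    move=> v0m; apply: IH => [|i|i ki]; first exact: ltnW.
      by rewrite row_setE; case: eqP => // _; case: v0m => ->; rewrite lexx ltW.
    rewrite row_setE; case: eqP => // ik; apply: xv.
    by rewrite ltn_neqAle ki andbT; apply/eqP => e; apply: ik; apply: val_inj.
  have xk := xbox k'.
  have t01 : Itv.spec (@Itv.num_sem R) (Itv.Real `[0%Z, 1%Z]) (x ord0 k' / m).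
    rewrite /=/Itv.num_sem/= num_real/= in_itv/= !ler_pdivrMr ?ler_pdivlMr//.
    by rewrite mul0r mul1r.
  have := cA _ _ (Itv.mk t01) (mem_set (side m (or_intror erefl)))
    (mem_set (side 0 (or_introl erefl))).
  move=> /set_mem; congr A; apply/rowP => i; rewrite convE/= !row_setE.
  case: eqP => [->|_]; last by ring.
  by field; rewrite gt_eqF.
by apply: (H n) => // i; rewrite leqNgt ltn_ord.
Qed.

(** The integers between [- 1/2] and [3/2 + 2n] are those from 0 to [2n + 1], and conversely the
    vertices of the box are lattice points of the cube. *)
Lemma integer_hull_half_cube (R : realType) (n : nat) :
  integer_hull (half_cube R n) = box n 0 (2 * n%:R + 1).
Proof.
apply/seteqP; split=> x.
  apply; split; first exact: convex_box.
  move=> y [yP yZ] i; have := yP i; case/intrP: (yZ i) => z ->.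
  have -> : 2 * n%:R + 1 = (2 * n + 1)%:Z%:~R :> R.
    by rewrite -pmulrn natrD natrM.
  move=> /andP[z0 z1]; rewrite -[0](_ : 0%Z%:~R = 0)// !ler_int.
  apply/andP; split; rewrite leNgt; apply/negP => zlt.
    have : z%:~R <= (-1)%:~R :> R by rewrite ler_int; lia.
    by rewrite mulrN1z; lra.
  have : (2 * n + 2)%:Z%:~R <= z%:~R :> R by rewrite ler_int; lia.
  by rewrite -pmulrn natrD natrM; lra.
move=> xbox A [cA PA]; have n0 : 0 <= n%:R :> R by [].
apply: box_sub_convex cA _ _ xbox => [|y yv]; first by lra.
apply: PA; split => i; first by case: (yv i) => ->; lra.
case: (yv i) => ->; first exact: rpred0.
by rewrite -natrM natr1 natr_int.
Qed.

(** * Trees and the split sets of their labels *)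

(** Labels are kept as pairs of normal and bound, a type with decidable equality, so that they can
    be counted with [\in] and [uniq]. *)
Fixpoint split_labels (R : realType) (n : nat) (C : cert_system R n)
    (t : bct C) : seq ('rV[int]_n * int) :=
  match t with
  | Leaf => [::]
  | Branch d t1 t2 =>
      (split_normal d, split_bound d) :: split_labels t1 ++ split_labels t2
  | Cut d _ _ t' => (split_normal d, split_bound d) :: split_labels t'
  end.

Definition split_set (R : realType) (n : nat) (p : 'rV[int]_n * int) :
    set 'rV[R]_n :=
  [set x | p.2%:~R < dotp (map_mx intr p.1) x < (p.2 + 1)%:~R].

Lemma bct_size_gt0 (R : realType) (n : nat) (C : cert_system R n) (t : bct C) :
  (0 < bct_size t)%N.
Proof. by case: t. Qed.

(** A binary tree has one more leaf than internal nodes, whence the strictness, which yields the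
    [+ 1] of the hull complexity. Certificates only add to the size. *)
Lemma size_split_labels (R : realType) (n : nat) (C : cert_system R n)
    (t : bct C) : (2 * size (split_labels t) < bct_size t)%N.
Proof.
elim: t => //= [d t1 IH1 t2 IH2|d H c t IH]; first by rewrite size_cat; lia.
by have := cert_size_gt0 c; lia.
Qed.

(* A cut keeps every point outside its split set, just like a branching. *)
Lemma outside_split_sets (R : realType) (n : nat) (C : cert_system R n)
    (D : set (split_disj n)) (Q K : set 'rV[R]_n) (t : bct C) (x : 'rV[R]_n) :
  bct_wf D K t -> bct_leaves_in Q K t -> K x ->
  (forall p, p \in split_labels t -> ~ split_set p x) -> Q x.
Proof.
have lo_hi d : ~ split_set (split_normal d, split_bound d) x ->
    split_lo d x \/ split_hi d x.
  rewrite /split_set/split_lo/split_hi/= => /negP; rewrite negb_and -!leNgt.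
  by case/orP; [left|right].
elim: t K => [|d t1 IH1 t2 IH2|d H c t IH] K /=.
- by move=> _ KQ Kx _; exact: KQ.
- move=> [_ wf1 wf2] [in1 in2] Kx out.
  have [xlo|xhi] := lo_hi d (out _ (mem_head _ _)).
    apply: IH1 wf1 in1 _ _ => // p pt; apply: out.
    by rewrite inE mem_cat pt orbT.
  apply: IH2 wf2 in2 _ _ => // p pt; apply: out.
  by rewrite inE mem_cat pt !orbT.
- move=> [_ [loH hiH] _ wf] int Kx out; apply: IH wf int _ _ => [|p pt].
    have [xlo|xhi] := lo_hi d (out _ (mem_head _ _)); split=> //.
      exact: loH.
    exact: hiH.
  by apply: out; rewrite inE pt orbT.
Qed.

(** * Grid points avoiding finitely many hyperplanes *)

Lemma avoid_values (R : realType) (s : seq R) :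
  exists2 k : nat, (k <= size s)%N & k%:R \notin s.
Proof.
apply/not_exists2P => H.
suff : (size (iota 0 (size s).+1) <= size s)%N by rewrite size_iota ltnn.
rewrite -(size_map (fun k => k%:R : R)); apply: uniq_leq_size.
  by rewrite map_inj_uniq ?iota_uniq//; apply: mulrIn; rewrite oner_eq0.
move=> _ /mapP[k + ->]; rewrite mem_iota add0n ltnS => ks.
by case: (H k) => // /negP; rewrite negbK.
Qed.

(* Greedy choice of the coordinates in increasing order: a hyperplane excludes
   at most one value, at the last coordinate on which it depends. *)
Lemma avoid_hyperplanes (R : realType) (n : nat) (s : seq ('rV[R]_n * R))
    (i : 'I_n) (v : R) :
  exists x : 'rV[R]_n, [/\ x ord0 i = v,
    forall j, j != i -> exists2 k : nat, (k <= size s)%N & x ord0 j = k%:R &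
    forall p, p \in s -> (exists2 j, j != i & p.1 ord0 j != 0) ->
      dotp p.1 x <> p.2].
Proof.
(* At stage [k], only the hyperplanes that do not depend on the coordinates from [k] on, apart from
   [i], have to be avoided. *)
have H k : (k <= n)%N -> exists x : 'rV[R]_n, [/\ x ord0 i = v,
    forall j, j != i -> exists2 k : nat, (k <= size s)%N & x ord0 j = k%:R &
    forall p, p \in s ->
      (forall j : 'I_n, (k <= j)%N -> j != i -> p.1 ord0 j = 0) ->
      (exists2 j, j != i & p.1 ord0 j != 0) ->
      dotp p.1 x <> p.2].
  elim: k => [_|k IH kn].
    exists (row_set 0 i v); split; first by rewrite row_setE eqxx.
      by move=> j /negPf ji; exists 0%N => //; rewrite row_setE ji mxE.
    by move=> p _ p0 [j ji]; rewrite p0// eqxx.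
  have [x [xi xs xp]] := IH (ltnW kn).
  pose k' := Ordinal kn.
  have leS (j : 'I_n) : (k <= j)%N -> j != k' -> (k < j)%N.
    by move=> kj jk; rewrite ltn_neqAle kj andbT eq_sym.
  have [ki|ki] := eqVneq k' i.
    exists x; split=> // p ps p0; apply: xp => // j kj ji.
    by apply: p0 => //; apply: leS => //; rewrite ki.
  (* Each listed value is the one at coordinate [k'] that puts the point on the hyperplane. If the
     hyperplane does not depend on [k'], the division by 0 merely forbids one harmless value. *)
  have [m] := avoid_values
    [seq (p.2 - dotp p.1 (row_set x k' 0)) / p.1 ord0 k' | p <- s].
  rewrite size_map => ms mbad.
  exists (row_set x k' m%:R); split.
  - by rewrite row_setE eq_sym (negPf ki).
  - move=> j ji; rewrite row_setE; case: eqP => _; last exact: xs.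
    by exists m.
  - move=> p ps p0 pi pE.
    have [pk|pk] := eqVneq (p.1 ord0 k') 0.
      apply: (xp p ps) => //; last first.
        by rewrite -pE dotp_row_set pk mul0r addr0.
      move=> j kj ji; have [->//|jk] := eqVneq j k'.
      by apply: p0 => //; exact: leS.
    move/negP: mbad; apply; apply/mapP; exists p => //.
    by rewrite -pE !dotp_row_set; field.
have [x [xi xs xp]] := H n (leqnn n).
exists x; split=> // p ps; apply: xp => // j.
by rewrite leqNgt ltn_ord.
Qed.

(** * Split sets covering the cube minus the box *)

Definition half_facet (R : realType) (n : nat) (b : bool) : R :=
  if b then 3 / 2 + 2 * n%:R else - (1 / 2).
Arguments half_facet R n b : clear implicits.

Lemma half_facet_half_int (R : realType) (n : nat) (b : bool) :
  2 * half_facet R n b \is a Num.int.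
Proof.
have -> : 2 * half_facet R n b = (if b then 3 + 4 * n%:R else -1).
  by rewrite /half_facet; case: b; field.
by case: b; rewrite ?rpredD ?rpredM ?rpredN ?rpred1 ?natr_int.
Qed.

(* On the facet [x_i = half_facet b] of the cube, a normal which is not
   parallel to the i-th axis takes half-integral values at the points whose
   other coordinates are integers, so that the split set contains such points
   on one hyperplane at most. *)
Lemma facet_split_set (R : realType) (n : nat) (s : seq ('rV[int]_n * int))
    (i : 'I_n) (b : bool) :
  (size s <= 2 * n + 1)%N ->
  (forall x, half_cube R n x -> ~ box n 0 (2 * n%:R + 1) x ->
     exists2 p, p \in s & split_set p x) ->
  exists p, [/\ p \in s, forall j, j != i -> p.1 ord0 j = 0 &
    p.2%:~R < (p.1 ord0 i)%:~R * half_facet R n b < (p.2 + 1)%:~R].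
Proof.
move=> sn cover.
(* The only half-integer strictly between [p.2] and [p.2 + 1] is [p.2 + 1 / 2], which gives the
   hyperplane to avoid. *)
have [x [xi xs xp]] := avoid_hyperplanes
  [seq (map_mx intr p.1 : 'rV[R]_n, p.2%:~R + 1 / 2) | p <- s] i
  (half_facet R n b).
have n0 : 0 <= n%:R :> R by [].
have [j|xbox|p ps xsp] := cover x.
- have [->|ji] := eqVneq j i.
    by rewrite xi /half_facet; case: b {xi}; apply/andP; split; lra.
  have [k + ->] := xs j ji; rewrite size_map => ks.
  (* The bound on [size s] keeps the chosen grid point in the cube. *)
  have : k%:R <= (2 * n + 1)%:R :> R by rewrite ler_nat (leq_trans ks).
  have : 0 <= k%:R :> R by [].
  by rewrite natrD natrM => *; apply/andP; split; lra.
- by have := xbox i; rewrite xi /half_facet; case: b {xi} => /andP[]; lra.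
have [p0|p0] := pselect (forall j, j != i -> p.1 ord0 j = 0).
  exists p; split=> //; move: xsp; rewrite /split_set/=.
  rewrite (@dotp_single _ _ _ _ i) ?xi ?mxE// => j ji.
  by rewrite mxE p0.
exfalso; apply: (xp _ (map_f _ ps)) => /=.
  move/existsNP: p0 => [j] /not_implyP[ji /eqP pj]; exists j => //.
  by rewrite mxE intr_eq0.
have /intrP[z zE] : 2 * dotp (map_mx intr p.1) x \is a Num.int.
  rewrite /dotp mulr_sumr rpred_sum// => j _; rewrite mxE.
  have [->|ji] := eqVneq j i.
    by rewrite xi mulrCA rpredM ?intr_int// half_facet_half_int.
  by have [k _ ->] := xs j ji; rewrite !rpredM ?intr_int ?natr_int.
move: xsp; rewrite /split_set/= => /andP[lo hi].
have : z = 2 * p.2 + 1.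
  have : (2 * p.2)%:~R < z%:~R :> R by rewrite -zE intrM ltr_pM2l.
  have : z%:~R < (2 * (p.2 + 1))%:~R :> R by rewrite -zE intrM ltr_pM2l.
  by rewrite !ltr_int; lia.
by move: zE => /[swap] ->; rewrite intrD intrM; lra.
Qed.

Lemma size_split_cover (R : realType) (n : nat) (s : seq ('rV[int]_n * int)) :
  (forall x, half_cube R n x -> ~ box n 0 (2 * n%:R + 1) x ->
     exists2 p, p \in s & split_set p x) ->
  (2 * n <= size s)%N.
Proof.
move=> cover; rewrite leqNgt; apply/negP => sn.
have [f fP] := choice (fun ib : 'I_n * bool => @facet_split_set R n s ib.1 ib.2
  (leq_trans (ltnW sn) (leq_addr _ _)) cover).
have f_inj : injective f.
  move=> [i b] [j c] e; have [_ fi fib] := fP (i, b).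
  have [_] := fP (j, c); rewrite -e => {e} fj fjc.
  move: (f (i, b)) fi fib fj fjc => [a be]/= fi fib fj fjc.
  (* A normal parallel to another axis vanishes at [i], but 0 is not strictly between two
     consecutive integers. *)
  have ij : i = j.
    apply/eqP; apply/negPn/negP => ij; move: fib; rewrite fj//.
    by rewrite mul0r -[0]/(0%:~R) !ltr_int; lia.
  rewrite -ij in fjc *; congr pair.
  apply/eqP; apply: contraT => bc.
  (* Opposite facets are [2n + 2] apart, so a nonzero integer [a_i] cannot send both into one open
     interval of length 1; [a_i = 0] is excluded as above. *)
  have a1 : a ord0 i <= -1 \/ a ord0 i = 0 \/ 1 <= a ord0 i by lia.
  have n0 : 0 <= n%:R :> R by [].
  move: fib fjc; rewrite !intrD; set A := (_ _)%:~R => /andP[] l1 u1 /andP[] l2 u2.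
  case: a1 => [|[a0|]].
  - rewrite -(ler_int R) mulrN1z -/A => A1.
    by move: b c bc l1 u1 l2 u2 => [] []//= _; rewrite /half_facet; nra.
  - by move: l1 u1; rewrite /A a0 mul0r -intrD -[0]/(0%:~R) !ltr_int; lia.
  - rewrite -(ler_int R) -/A => A1.
    by move: b c bc l1 u1 l2 u2 => [] []//= _; rewrite /half_facet; nra.
have : (size (map f (enum {: 'I_n * bool})) <= size s)%N.
  apply: uniq_leq_size => [|_ /mapP[ib _ ->]]; last by case: (fP ib).
  by rewrite map_inj_uniq ?enum_uniq.
by rewrite size_map -cardE card_prod card_ord card_bool mulnC leqNgt sn.
Qed.

(** * Sides of the box and the trees that branch on them *)

Definition side (R : realType) (n : nat) (ib : 'I_n * bool) : set 'rV[R]_n :=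
  box n 0 (2 * n%:R + 1) `&`
  [set x | x ord0 ib.1 = if ib.2 then 2 * n%:R + 1 else 0].

Definition side_halfspace (R : realType) (n : nat) (ib : 'I_n * bool) :
    set 'rV[R]_n :=
  [set x | if ib.2 then x ord0 ib.1 <= 2 * n%:R + 1 else 0 <= x ord0 ib.1].

Arguments side R {n} ib.
Arguments side_halfspace R {n} ib.

Lemma delta_row_neq0 (n : nat) (i : 'I_n) : delta_mx ord0 i != 0 :> 'rV[int]_n.
Proof. by apply/rV0Pn; exists i; rewrite mxE !eqxx. Qed.

(** The bounds are such that one half of the disjunction misses the cube and the other lies in
    [side_halfspace]. *)
Definition side_split (n : nat) (ib : 'I_n * bool) : split_disj n :=
  SplitDisj (if ib.2 then (2 * n + 1)%:Z else -1) (delta_row_neq0 ib.1).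

Lemma half_cube_split_lo (R : realType) (n : nat) (i : 'I_n) (x : 'rV[R]_n) :
  half_cube R n x -> ~ split_lo (side_split (i, false)) x.
Proof.
move=> xP; rewrite /split_lo/= dotp_delta mulrN1z.
by have /andP[] := xP i; lra.
Qed.

Lemma half_cube_split_hi (R : realType) (n : nat) (i : 'I_n) (x : 'rV[R]_n) :
  half_cube R n x -> ~ split_hi (side_split (i, true)) x.
Proof.
move=> xP; rewrite /split_hi/= dotp_delta intrD -pmulrn natrD natrM.
by have /andP[] := xP i; lra.
Qed.

Lemma split_lo_side (R : realType) (n : nat) (i : 'I_n) :
  split_lo (side_split (i, true)) `<=` side_halfspace R (i, true).
Proof.
by move=> x; rewrite /split_lo/= dotp_delta -pmulrn natrD natrM.
Qed.

Lemma split_hi_side (R : realType) (n : nat) (i : 'I_n) :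
  split_hi (side_split (i, false)) `<=` side_halfspace R (i, false).
Proof. by move=> x; rewrite /split_hi/= dotp_delta. Qed.

Lemma box_side_halfspace (R : realType) (n : nat) (x : 'rV[R]_n) :
  (forall ib, side_halfspace R ib x) -> box n 0 (2 * n%:R + 1) x.
Proof.
by move=> H i; apply/andP; split; [apply: (H (i, false))|apply: (H (i, true))].
Qed.

(** A caterpillar whose side leaves carry empty sets when the root lies in the cube. It uses
    branchings only, since the certificate language may be empty. *)
Fixpoint sides_tree (R : realType) (n : nat) (C : cert_system R n)
    (l : seq ('I_n * bool)) : bct C :=
  match l with
  | [::] => Leaf C
  | (i, true) :: l' =>
      Branch (side_split (i, true)) (sides_tree C l') (Leaf C)
  | (i, false) :: l' =>
      Branch (side_split (i, false)) (Leaf C) (sides_tree C l')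
  end.

Lemma size_sides_tree (R : realType) (n : nat) (C : cert_system R n)
    (l : seq ('I_n * bool)) : bct_size (sides_tree C l) = (2 * size l + 1)%N.
Proof. by elim: l => [|[i [] l IH]]//=; rewrite IH; lia. Qed.

Lemma sides_tree_wf (R : realType) (n : nat) (C : cert_system R n)
    (D : set (split_disj n)) (K : set 'rV[R]_n) (l : seq ('I_n * bool)) :
  variable_disj n `<=` D -> bct_wf D K (sides_tree C l).
Proof.
move=> vD.
have sD ib : D (side_split ib) by apply: vD; exists ib.1.
by elim: l K => [|[i [] l IH] K]//=.
Qed.

Lemma sides_tree_leaves (R : realType) (n : nat) (C : cert_system R n)
    (Q K : set 'rV[R]_n) (l : seq ('I_n * bool)) :
  K `<=` half_cube R n ->
  (forall x, K x -> (forall ib, ib \in l -> side_halfspace R ib x) -> Q x) ->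
  bct_leaves_in Q K (sides_tree C l).
Proof.
elim: l K => [|[i b] l IH] K /= KP KQ; first by move=> x Kx; exact: KQ.
case: b KQ => KQ /=; split.
- apply: IH => [x [/KP]//|x [Kx xlo] xl]; apply: KQ => // ib.
  by rewrite inE => /predU1P[->|/xl//]; exact: split_lo_side.
- by move=> x [/KP xP xhi]; case: (half_cube_split_hi xP xhi).
- by move=> x [/KP xP xlo]; case: (half_cube_split_lo xP xlo).
- apply: IH => [x [/KP]//|x [Kx xlo] xl]; apply: KQ => // ib.
  by rewrite inE => /predU1P[->|/xl//]; exact: split_hi_side.
Qed.

(** * The facets of the box are its sides *)

Definition side_normal (R : realType) (n : nat) (ib : 'I_n * bool) : 'rV[R]_n :=
  (if ib.2 then 1 else -1) *: delta_mx ord0 ib.1.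

Arguments side_normal R {n} ib.

Lemma dotp_side_normal (R : realType) (n : nat) (ib : 'I_n * bool)
    (x : 'rV[R]_n) :
  dotp (side_normal R ib) x = if ib.2 then x ord0 ib.1 else - x ord0 ib.1.
Proof.
rewrite (@dotp_single _ _ _ _ ib.1) => [|j /negPf ji]; rewrite !mxE ?ji/= ?mulr0//.
by rewrite !eqxx mulr1; case: ifP; rewrite ?mul1r ?mulN1r.
Qed.

Lemma side_halfspaceE (R : realType) (n : nat) (ib : 'I_n * bool) :
  side_halfspace R ib =
  closed_halfspace (side_normal R ib) (if ib.2 then 2 * n%:R + 1 else 0).
Proof.
apply/seteqP; rewrite /side_halfspace/closed_halfspace.
by split=> x /=; rewrite dotp_side_normal; case: ib.2 => //; rewrite oppr_le0.
Qed.

Lemma sideE (R : realType) (n : nat) (ib : 'I_n * bool) :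
  side R ib = box n 0 (2 * n%:R + 1) `&`
    hyperplane (side_normal R ib) (if ib.2 then 2 * n%:R + 1 else 0).
Proof.
congr (_ `&` _); apply/seteqP; rewrite /hyperplane.
split=> x /=; rewrite dotp_side_normal; case: ib.2 => //.
  by move=> ->; rewrite oppr0.
by move/eqP; rewrite oppr_eq0 => /eqP.
Qed.

Lemma box_sub_side_halfspace (R : realType) (n : nat) (ib : 'I_n * bool) :
  box n 0 (2 * n%:R + 1) `<=` side_halfspace R ib.
Proof.
by move=> x xbox; rewrite /side_halfspace/=; have /andP[] := xbox ib.1; case: ib.2.
Qed.

(** The centre of a side lies on no other side. *)
Lemma side_sub_inj (R : realType) (n : nat) (ib jc : 'I_n * bool) :
  side R ib `<=` side R jc -> ib = jc.
Proof.
case: ib jc => i b [j c].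
have n0 : 0 <= n%:R :> R by [].
pose x : 'rV[R]_n :=
  row_set (const_mx ((2 * n%:R + 1) / 2)) i (if b then 2 * n%:R + 1 else 0).
move=> /(_ x)[].
  split; last by rewrite /x/= row_setE eqxx.
  move=> k; rewrite /x row_setE mxE.
  by case: eqP => _; [case: b {x}|]; apply/andP; split; lra.
move=> _; rewrite /x/= row_setE mxE.
case: eqP => [->|_].
  by case: b {x} => //; case: c => // ?; exfalso; lra.
by case: c => ?; exfalso; lra.
Qed.

Lemma side_proper_face (R : realType) (n : nat) (ib : 'I_n * bool) :
  proper_face (box n 0 (2 * n%:R + 1)) (side R ib).
Proof.
have n0 : 0 <= n%:R :> R by [].
split.
- exists (side_normal R ib), (if ib.2 then 2 * n%:R + 1 else 0).
  by rewrite -side_halfspaceE -sideE; split=> //; exact: box_sub_side_halfspace.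
- exists (const_mx (if ib.2 then 2 * n%:R + 1 else 0)); split; last by rewrite /= mxE.
  by move=> i; rewrite mxE; case: ib.2; apply/andP; split; lra.
(* If a side were the whole box, it would contain the opposite side. *)
- move=> sE.
  have : side R (ib.1, ~~ ib.2) `<=` side R ib by rewrite sE => x [].
  by move=> /side_sub_inj/(congr1 snd)/=; case: ib.2.
Qed.

(** A properly supporting functional has some [a_i] nonzero. Pushing [x_i] to its bound in the
    direction of the sign of [a_i] would increase the functional beyond its maximum, unless [x_i] is
    already there. *)
Lemma proper_face_sub_side (R : realType) (n : nat) (F : set 'rV[R]_n) :
  proper_face (box n 0 (2 * n%:R + 1)) F -> exists ib, F `<=` side R ib.
Proof.
have n0 : 0 <= n%:R :> R by [].
move=> [[a [c [Qac ->]]] [y [_ yc]] FQ].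
have [a0|/rV0Pn[i ai]] := eqVneq a 0.
  case: FQ; apply/seteqP; split=> [x []//|x Qx]; split=> //.
  by rewrite /hyperplane/= -yc /dotp !big1// => j _; rewrite a0 mxE mul0r.
exists (i, 0 < a ord0 i) => x [xbox xc]; split=> //=.
set v : R := (X in _ = X).
have vQ : box n 0 (2 * n%:R + 1) (row_set x i v).
  move=> j; rewrite row_setE; case: eqP => // _.
  by rewrite /v; case: ifP => _; apply/andP; split; lra.
have := Qac _ vQ; rewrite /closed_halfspace/= dotp_row_set xc => H.
have /andP[xi0 xi1] := xbox i.
move: H; rewrite /v; case: ltP => [a_gt0|a_le0] H.
  by apply/eqP; rewrite eq_le xi1/=; nra.
have {}ai : a ord0 i < 0 by rewrite lt_neqAle ai.
by apply/eqP; rewrite eq_le xi0 andbT; nra.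
Qed.

(** Every proper face lies in a side, and distinct sides are incomparable, so the sides are the
    maximal proper faces. *)
Lemma facetP (R : realType) (n : nat) (F : set 'rV[R]_n) :
  facet (box n 0 (2 * n%:R + 1)) F <-> exists ib, F = side R ib.
Proof.
split=> [[pF Fmax]|[ib ->]].
  have [ib Fib] := proper_face_sub_side pF; exists ib.
  by rewrite (Fmax _ (side_proper_face R ib)).
split=> [|G pG ibG]; first exact: side_proper_face.
have [jc Gjc] := proper_face_sub_side pG.
have ij := side_sub_inj (subset_trans ibG Gjc).
by apply/seteqP; split=> //; rewrite ij.
Qed.

(** * Validity complexity of the sides *)

(** The cube exceeds the box by [1 / 2] in each direction, so a point of the box on the bounding
    hyperplane can be moved out of [H] along a coordinate axis within the cube. Hence a single leaf
    never proves [H]. *)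
Lemma supporting_not_valid (R : realType) (n : nat) (F H : set 'rV[R]_n) :
  F !=set0 -> defines_facet (box n 0 (2 * n%:R + 1)) F H ->
  ~ half_cube R n `<=` H.
Proof.
move=> [x Fx] [a [c [/rV0Pn[i ai] -> _ FE]]] PH.
have n0 : 0 <= n%:R :> R by [].
move: Fx; rewrite FE => -[xbox xc].
pose e : R := if 0 < a ord0 i then 1 / 2 else - (1 / 2).
have ae : 0 < a ord0 i * e.
  rewrite /e; case: (ltP 0 (a ord0 i)) => [a_gt0|a_le0]; first by nra.
  have {}ai : a ord0 i < 0 by rewrite lt_neqAle ai.
  by nra.
have /PH : half_cube R n (row_set x i (x ord0 i + e)).
  move=> j; rewrite row_setE; have := xbox j; case: eqP => [->|_] /andP[].
    by rewrite /e; case: ifP => _ *; apply/andP; split; lra.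
  by move=> *; apply/andP; split; lra.
rewrite /closed_halfspace/= dotp_row_set xc [_ + e]addrC addrK.
by rewrite gerDl leNgt ae.
Qed.

Lemma validity_lower_bound (R : realType) (n : nat) (C : cert_system R n)
    (D : set (split_disj n)) (P H : set 'rV[R]_n) (t : bct C) :
  ~ P `<=` H -> bct_proves D P H t -> (3 <= bct_size t)%N.
Proof.
move=> PH [_ _]; case: t => [//|d t1 t2|d G c t] _ /=.
  by have := bct_size_gt0 t1; have := bct_size_gt0 t2; lia.
by have := bct_size_gt0 t; lia.
Qed.

(** One branching on [side_split ib] suffices. The bound [lb] holds for every halfspace defining the
    side, hence serves both nested minima. *)
Lemma side_validity_complexity (R : realType) (n : nat) (C : cert_system R n)
    (D : set (split_disj n)) (ib : 'I_n * bool) :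
  variable_disj n `<=` D ->
  facet_validity_complexity C D (half_cube R n) (side R ib) 3.
Proof.
move=> vD; have [_ ne _] := side_proper_face R ib.
have lb H t : defines_facet (box n 0 (2 * n%:R + 1)) (side R ib) H ->
    bct_proves D (half_cube R n) H (t : bct C) -> (3 <= bct_size t)%N.
  by move=> /(supporting_not_valid ne); exact: validity_lower_bound.
rewrite /facet_validity_complexity integer_hull_half_cube.
split=> [|m [H dH [[t tH <-] _]]]; last exact: lb tH.
have dib : defines_facet (box n 0 (2 * n%:R + 1)) (side R ib) (side_halfspace R ib).
  exists (side_normal R ib), (if ib.2 then 2 * n%:R + 1 else 0).
  split; [|exact: side_halfspaceE|exact: box_sub_side_halfspace|exact: sideE].
  rewrite /side_normal scaler_eq0 negb_or; apply/andP; split.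
    by case: ib.2; rewrite ?oppr_eq0 oner_eq0.
  by apply/rV0Pn; exists ib.1; rewrite mxE !eqxx oner_eq0.
exists (side_halfspace R ib) => //; split; last by move=> _ [t tH <-]; exact: lb tH.
exists (sides_tree C [:: ib]); last by rewrite size_sides_tree.
split; last 2 first.
- exact: sides_tree_wf.
- by apply: sides_tree_leaves => // x _; apply; rewrite mem_head.
by rewrite integer_hull_half_cube; exact: box_sub_side_halfspace.
Qed.

Local Close Scope ring_scope.

Theorem theorem4p17 (R : realType) (n : nat) (n_gt0 : (0 < n)%N)
    (C : cert_system R n) (D : set (split_disj n))
    (D_variable : variable_disj n `<=` D) :
  facet_complexity C D (half_cube R n) 3 /\
  hull_complexity C D (half_cube R n) (4 * n + 1)%N.
Proof.
split.
  rewrite /facet_complexity integer_hull_half_cube; split.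
    exists (side R (Ordinal n_gt0, true)); first by apply/facetP; eexists.
    exact: side_validity_complexity.
  move=> F /facetP[ib ->]; exists 3 => //; exact: side_validity_complexity.
split.
  exists (sides_tree C (enum {: 'I_n * bool})); last first.
    by rewrite size_sides_tree -cardE card_prod card_ord card_bool; lia.
  split; first by [].
    exact: sides_tree_wf.
  apply: sides_tree_leaves => // x _ xs; rewrite integer_hull_half_cube.
  by apply: box_side_halfspace => ib; apply: xs; rewrite mem_enum.
move=> _ [t [_ wf leaves] <-].
suff : (2 * n <= size (split_labels t))%N by have := size_split_labels t; lia.
apply: (@size_split_cover R) => x xP xbox.
(* A point of the cube in no split set would reach a leaf and thus lie in the hull. *)
apply: contrapT => /forall2NP out; apply: xbox.
rewrite -integer_hull_half_cube; apply: outside_split_sets wf leaves xP _ => p pt.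
by case: (out p).
Qed.
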